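(* (Type $q$-P$(A_7')$.) Let $Y(x)={}^t(y_1(x),y_2(x))$ be meromorphic on $\mathbb{C}^*$ and satisfy $Y(qx)=A(x)Y(x)$ with the matrix $A(x)$ of the context. Then $$y_1(q^2x)-\frac{q^2\kappa_1x^3-b_2x^2+b_1x-\lambda\theta_1t}{x-\lambda}y_1(qx)+\frac{\kappa_1\kappa_2x^2(qx-\lambda)}{x-\lambda}y_1(x)=0,$$ $$b_2=q(q+1)\kappa_1\lambda-\frac{q^2\kappa_1\kappa_2\mu}{\lambda}+\frac{q\theta_1t}{\lambda}-\frac{\lambda}{\mu},\qquad b_1=q\kappa_1\lambda^2-q\kappa_1\kappa_2\mu+(q+1)\theta_1t-\frac{\lambda^2}{\mu}.$$ If one sets $\mu=\frac{\theta_1t}{q\kappa_1\kappa_2}+d\lambda$ with a constant $d\in\mathbb{C}$ and lets $\lambda\to0$ (all other parameters fixed), then the coefficients of this equation converge, for each fixed $x\neq0$, to those of $$y_1(q^2x)-q(q\kappa_1x^2+q\kappa_1\kappa_2d\,x+\theta_1t)y_1(qx)+q\kappa_1\kappa_2x^2y_1(x)=0.$$ If $y_1$ satisfies this limit equation, then $f(x)=y_1(qx)$ satisfies $$f(qx)-q(q\kappa_1x^2+q\kappa_1\kappa_2d\,x+\theta_1t)f(x)+q\kappa_1\kappa_2x^2f(x/q)=0.$$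
   Context: Let $q,t,\kappa_1,\kappa_2,\theta_1,\lambda,\mu,\omega$ be nonzero complex numbers. The matrix is $$A(x)=\begin{pmatrix}\kappa_1\{(x-\lambda)(x-\alpha)+\mu_1\}&\omega(x-\lambda)\\ \kappa_1\omega^{-1}(\gamma x+\delta)&\mu_2\end{pmatrix},$$ $$\mu_1=\frac{\lambda^2}{q\kappa_1\mu},\quad \mu_2=q\kappa_1\kappa_2\mu,\quad \alpha=\frac{\lambda^{-1}(\theta_1t-\kappa_1\mu_1-\mu_2)}{\kappa_1},\quad \gamma=\mu_2-\kappa_2,\quad \delta=-\lambda^{-1}\mu_2(\alpha\lambda+\mu_1).$$ (This is the linear system of Murata's Lax form for the $q$-Painlevé equation of type $A_7'$; it satisfies $\det A(x)=\kappa_1\kappa_2x^2$.) Equations are understood as identities of meromorphic functions. *)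

(* Defs.v *)
From HB Require Import structures.
From mathcomp Require Import all_boot all_order all_algebra.
From mathcomp Require Import complex.
From mathcomp Require Import all_classical all_reals all_analysis.

Set Implicit Arguments.
Unset Strict Implicit.
Unset Printing Implicit Defensive.

Import Order.TTheory GRing.Theory Num.Theory numFieldNormedType.Exports.

Local Open Scope classical_set_scope.
Local Open Scope ring_scope.

(* The field R[i], as a numClosedFieldType: it then gets the topology and the
   normed module structure over itself given by the complex modulus, so that
   [derivable] below is complex differentiability. *)
Definition Cplx (R : realType) : numClosedFieldType := complex R.

Definition holomorphic_at (R : realType) (g : Cplx R -> Cplx R) (z : Cplx R) :=
  \forall w \near z, derivable g w 1.

(* Meromorphic functions are represented by total functions, with arbitrary
   values at the poles: near z and off z, f is a quotient of functions
   holomorphic at z whose denominator has no zero there. *)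
Definition meromorphic_at (R : realType) (f : Cplx R -> Cplx R) (z : Cplx R) :=
  exists g h : Cplx R -> Cplx R,
    [/\ holomorphic_at g z, holomorphic_at h z
      & \forall w \near z^', h w != 0 /\ f w = g w / h w].

Definition meromorphic_Cstar (R : realType) (f : Cplx R -> Cplx R) :=
  forall z : Cplx R, z != 0 -> meromorphic_at f z.

(* An identity P between meromorphic functions on C^* holds outside a closed
   discrete subset of C^*: since the values at poles are arbitrary, every
   point of C^* has a punctured neighbourhood on which P holds. *)
Definition mero_identity (R : realType) (P : Cplx R -> Prop) :=
  forall z : Cplx R, z != 0 -> \forall x \near z^', P x.

Definition mx22 (K : Type) (a b c d : K) : 'M[K]_2 :=
  \matrix_(i, j) if i == 0 then (if j == 0 then a else b)
                 else (if j == 0 then c else d).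

Section LaxMatrix.
Variables (R : realType) (q t k1 k2 th1 lam mu om : Cplx R).

Let mu1 : Cplx R := lam ^+ 2 / (q * k1 * mu).
Let mu2 : Cplx R := q * k1 * k2 * mu.
Let alpha : Cplx R := lam^-1 * (th1 * t - k1 * mu1 - mu2) / k1.
Let gamma : Cplx R := mu2 - k2.
Let delta : Cplx R := - (lam^-1 * mu2 * (alpha * lam + mu1)).

Definition laxA (x : Cplx R) : 'M[Cplx R]_2 :=
  mx22 (k1 * ((x - lam) * (x - alpha) + mu1)) (om * (x - lam))
       (k1 * om^-1 * (gamma * x + delta))     mu2.

Definition lax_b2 : Cplx R :=
  q * (q + 1) * k1 * lam - q ^+ 2 * k1 * k2 * mu / lam
  + q * th1 * t / lam - lam / mu.

Definition lax_b1 : Cplx R :=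
  q * k1 * lam ^+ 2 - q * k1 * k2 * mu + (q + 1) * th1 * t - lam ^+ 2 / mu.

(* The coefficients of y1(qx) and y1(x) in the second-order equation; that of
   y1(q^2 x) is 1. *)
Definition coef_qx (x : Cplx R) : Cplx R :=
  - ((q ^+ 2 * k1 * x ^+ 3 - lax_b2 * x ^+ 2 + lax_b1 * x - lam * th1 * t)
     / (x - lam)).

Definition coef_x (x : Cplx R) : Cplx R :=
  k1 * k2 * x ^+ 2 * (q * x - lam) / (x - lam).

End LaxMatrix.

(* Main.v *)
Require Import Defs.
From HB Require Import structures.
From mathcomp Require Import all_boot all_order all_algebra.
From mathcomp Require Import complex.
From mathcomp Require Import all_classical all_reals all_analysis.
From mathcomp Require Import ring.
Import Order.TTheory GRing.Theory Num.Theory numFieldNormedType.Exports.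
Local Open Scope classical_set_scope.
Local Open Scope ring_scope.

(* Solving the first row of Y(qx) = A(x) Y(x) for y2 and substituting into the
   second iterate gives
     y1(q^2 x) - (A_11(qx) + A_22 (qx - lam) / (x - lam)) y1(qx)
       + (qx - lam) / (x - lam) det A(x) y1(x) = 0,
   and det A(x) = k1 k2 x^2.  For mu = th1 t / (q k1 k2) + d lam the two terms of
   b2 that are singular at lam = 0 add up to the constant - q^2 k1 k2 d, so the
   coefficients extend continuously to lam = 0. *)

Lemma nbhs_neq {K : numFieldType} (z a : K) : z != a -> \forall x \near z, x != a.
Proof.
rewrite -subr_eq0 => za.
have c : (fun x : K => x - a) x @[x --> z] --> z - a.
  exact: (cvgB cvg_id (cvg_cst a)).
near=> x; rewrite -subr_eq0; near: x; exact: (cvgr_neq0 _ c za).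
Unshelve. all: by end_near.
Qed.

(** Puncturing handles [z = a], so the pole [x = lam] can be avoided around every base point. *)
Lemma dnbhs_neq_near {K : numFieldType} (z a : K) : \forall x \near z^', x != a.
Proof.
have [->|za] := eqVneq z a; first exact: nbhs_dnbhs_neq.
exact/nbhs_dnbhs/nbhs_neq.
Qed.

(** Multiplication by [q] is continuous and, being injective, keeps punctured neighbourhoods
    punctured. This allows the Lax equation to be read at [q * x]. *)
Lemma dnbhs_mull {K : numFieldType} {q z : K} {P : set K} : q != 0 ->
  (\forall x \near (q * z)^', P x) -> \forall x \near z^', P (q * x).
Proof.
move=> q0; rewrite /dnbhs !near_withinE => PH.
have Pq : \forall x \near z, q * x != q * z -> P (q * x).
  have c : q * x @[x --> z] --> q * z by exact: mulrl_continuous.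
  exact: (c _ PH).
near=> x => xz; apply: (near Pq x) => //.
by rewrite (inj_eq (mulfI q0)).
Unshelve. all: by end_near.
Qed.

Section Elimination.
Context {R : realType} {q t k1 k2 th1 lam mu om : Cplx R}.
Hypotheses (hq : q != 0) (hk1 : k1 != 0) (hlam : lam != 0)
  (hmu : mu != 0) (hom : om != 0).

Let A := laxA q t k1 k2 th1 lam mu om.

(** With the given gamma and delta, the left side becomes k1 ((x - lam) (k2 x + mu1 mu2 / lam) + mu1
    mu2), and mu1 mu2 = k2 lam^2. *)
Lemma laxA_det x : A x 0 0 * A x 1 1 - A x 0 1 * A x 1 0 = k1 * k2 * x ^+ 2.
Proof.
rewrite /A /laxA !mxE /=; field.
by rewrite hlam hmu hq hk1 hom.
Qed.

(** After multiplication by x - lam, both sides are polynomials in x. The choice of alpha gives k1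
    (alpha lam + mu1) + mu2 = th1 t, whence the constant term - lam th1 t of the numerator. *)
Lemma coef_qxE {x} : x != lam ->
  coef_qx q t k1 k2 th1 lam mu x =
  - (A (q * x) 0 0 + A x 1 1 * (q * x - lam) / (x - lam)).
Proof.
rewrite -subr_eq0 => xl.
rewrite /A /laxA !mxE /= /coef_qx /lax_b1 /lax_b2; field.
by rewrite hlam hmu hq hk1 xl.
Qed.

Lemma laxA_elimination {u0 u1 u2 : 'cV[Cplx R]_2} {x} : x != lam ->
  u1 = A x *m u0 -> u2 = A (q * x) *m u1 ->
  u2 0 0 + coef_qx q t k1 k2 th1 lam mu x * u1 0 0
    + coef_x q k1 k2 lam x * u0 0 0 = 0.
Proof.
move=> xl e1 e2; rewrite coef_qxE // /coef_x -laxA_det.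
have mulA2 (B : 'M[Cplx R]_2) (u : 'cV[Cplx R]_2) i :
    (B *m u) i 0 = B i 0 * u 0 0 + B i 1 * u 1 0.
  by rewrite mxE !big_ord_recl big_ord0 addr0; congr (_ + B i _ * u _ 0);
    apply: val_inj.
(* Only this entry has to be explicit: both iterates are expanded in [u0], and the coefficient of
   [u0 1 0] cancels because A_12(qx) / A_12(x) = (qx - lam) / (x - lam). *)
have A01 y : A y 0 1 = om * (y - lam) by rewrite !mxE.
rewrite e2 mulA2 e1 !mulA2 !A01; field.
by rewrite subr_eq0.
Qed.

End Elimination.

Section RegularForm.
Context {K : numFieldType} (q k1 k2 s d x : K).

(* [coef_qx] at lam = l after the cancellation in [lax_b2], with s = th1 * t,
   m = mu and mV = mu^-1. *)
Definition regular_coef_qx (l m mV : K) : K :=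
  - ((q ^+ 2 * k1 * x ^+ 3
      - (q * (q + 1) * k1 * l - q ^+ 2 * k1 * k2 * d - l * mV) * x ^+ 2
      + (q * k1 * (l * l) - q * k1 * k2 * m + (q + 1) * s - l * l * mV) * x
      - l * s) * (x - l)^-1).

(** The only inverses, of [m] and of [x - l], have nonzero limits [m0] and [x]; the rest is algebra
    of limits. *)
Lemma cvg_regular_coef_qx {T : Type} {F : set_system T} {FF : Filter F}
    (l m : T -> K) (m0 : K) : x != 0 -> m0 != 0 ->
  l i @[i --> F] --> (0 : K) -> m i @[i --> F] --> m0 ->
  regular_coef_qx (l i) (m i) (m i)^-1 @[i --> F] --> regular_coef_qx 0 m0 m0^-1.
Proof.
move=> hx hm cl cm; have cmV := cvgV hm cm.
have cc (a : K) : (fun=> a) @ F --> a by exact: cvg_cst.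
apply: cvgN; apply: cvgM; last first.
  by apply: cvgV; [rewrite subr0|exact: cvgB (cc x) cl].
apply: cvgB; last exact: cvgM cl (cc s).
apply: cvgD; last first.
  apply: cvgM; last exact: cc.
  apply: cvgB; last by apply: cvgM; [exact: cvgM|exact: cmV].
  apply: cvgD; last exact: cc.
  apply: cvgB; last exact: cvgM (cc _) cm.
  by apply: cvgM; [exact: cc|exact: cvgM].
apply: cvgB; first exact: cc.
apply: cvgM; last exact: cc.
apply: cvgB; last by apply: cvgM; [|exact: cmV].
exact: cvgB (cvgM (cc _) cl) (cc _).
Qed.

Lemma cvg_linear_fractional {T : Type} {F : set_system T} {FF : Filter F} (l : T -> K)
    (a b : K) : x != 0 -> l i @[i --> F] --> (0 : K) ->
  a * (b - l i) / (x - l i) @[i --> F] --> a * (b - 0) / (x - 0).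
Proof.
move=> hx cl.
have cc (c : K) : (fun=> c) @ F --> c by exact: cvg_cst.
apply: cvgM; last first.
  by apply: cvgV; [rewrite subr0|exact: cvgB (cc x) cl].
exact: cvgM (cc a) (cvgB (cc b) cl).
Qed.

End RegularForm.

Section Limit.
Context {R : realType} {q t k1 k2 th1 d x : Cplx R}.
Hypotheses (hq : q != 0) (ht : t != 0) (hk1 : k1 != 0) (hk2 : k2 != 0)
  (hth1 : th1 != 0) (hx : x != 0).

Let mu (lam : Cplx R) : Cplx R := th1 * t / (q * k1 * k2) + d * lam.

Lemma cvg_mu : mu lam @[lam --> 0^'] --> mu 0.
Proof.
apply: cvgD; first exact: cvg_cst.
by apply: cvgM; [exact: cvg_cst|exact: cvg_within].
Qed.

Lemma mu0_neq0 : mu 0 != 0.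
Proof. by rewrite /mu mulr0 addr0 !(mulf_neq0, invr_neq0). Qed.

Lemma coef_qx_regular {lam : Cplx R} : lam != 0 -> mu lam != 0 -> x != lam ->
  coef_qx q t k1 k2 th1 lam (mu lam) x =
  regular_coef_qx q k1 k2 (th1 * t) d x lam (mu lam) (mu lam)^-1.
Proof.
rewrite -(subr_eq0 x) => hlam hmu xl.
rewrite /coef_qx /lax_b2 /lax_b1 /regular_coef_qx.
(* This is [mu lam] times [q * k1 * k2], the denominator that [field] meets after unfolding [mu]. *)
have hm : th1 * t + d * lam * (q * k1 * k2) != 0.
  apply: contraNneq hmu => h; rewrite /mu; apply/eqP.
  by apply: (mulIf (mulf_neq0 (mulf_neq0 hq hk1) hk2)); rewrite mul0r -h;
    field; rewrite hq hk1 hk2.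
by rewrite /mu; field; rewrite hlam hq hk1 hk2 hm xl.
Qed.

Lemma cvg_coef_qx : coef_qx q t k1 k2 th1 lam (mu lam) x @[lam --> 0^']
  --> - (q * (q * k1 * x ^+ 2 + q * k1 * k2 * d * x + th1 * t)).
Proof.
have hmu := mu0_neq0.
have cl : lam @[lam --> (0 : Cplx R)^'] --> (0 : Cplx R) by exact: cvg_within.
(* Since q k1 k2 mu(0) = th1 t, the linear term of the numerator at lam = 0 reduces to q th1 t x,
   and one factor x cancels. *)
have -> : - (q * (q * k1 * x ^+ 2 + q * k1 * k2 * d * x + th1 * t)) =
    regular_coef_qx q k1 k2 (th1 * t) d x 0 (mu 0) (mu 0)^-1.
  rewrite /regular_coef_qx /mu !(mulr0, mul0r, subr0, addr0).
  by field; rewrite hq hk1 hk2 hx.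
have cG := cvg_regular_coef_qx q k1 k2 (th1 * t) d x (FF := dnbhs_filter _)
  _ _ _ hx hmu cl cvg_mu.
(* The two forms may differ at [lam = 0] itself, where division by zero returns 0; the punctured
   filter ignores that point. *)
have E : \forall lam \near (0 : Cplx R)^',
    regular_coef_qx q k1 k2 (th1 * t) d x lam (mu lam) (mu lam)^-1 =
    coef_qx q t k1 k2 th1 lam (mu lam) x.
  near=> lam; apply/esym/coef_qx_regular; near: lam.
  - exact: nbhs_dnbhs_neq.
  - exact: (cvgr_neq0 _ cvg_mu hmu).
  - near=> l; rewrite eq_sym; near: l; exact: dnbhs_neq_near.
exact: (cvg_trans (near_eq_cvg (FF := dnbhs_filter _) E) cG).
Unshelve. all: by end_near.
Qed.

Lemma cvg_coef_x : coef_x q k1 k2 lam x @[lam --> 0^'] --> q * k1 * k2 * x ^+ 2.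
Proof.
have -> : q * k1 * k2 * x ^+ 2 = k1 * k2 * x ^+ 2 * (q * x - 0) / (x - 0).
  by field.
apply: (cvg_linear_fractional _ (FF := dnbhs_filter _) _ _ _ hx).
exact: cvg_within.
Qed.

End Limit.

Theorem mainTheorem9 (R : realType) (q t k1 k2 th1 : Cplx R)
  (hq : q != 0) (ht : t != 0) (hk1 : k1 != 0) (hk2 : k2 != 0)
  (hth1 : th1 != 0) :
  (forall (lam mu om : Cplx R), lam != 0 -> mu != 0 -> om != 0 ->
   forall Y : Cplx R -> 'cV[Cplx R]_2,
     (forall i, meromorphic_Cstar (fun x => Y x i 0)) ->
     mero_identity (fun x =>
       Y (q * x) = laxA q t k1 k2 th1 lam mu om x *m Y x) ->
     let y1 := fun x : Cplx R => Y x 0 0 in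
     mero_identity (fun x =>
       y1 (q ^+ 2 * x)
       + coef_qx q t k1 k2 th1 lam mu x * y1 (q * x)
       + coef_x q k1 k2 lam x * y1 x = 0))
  /\
  (forall d : Cplx R,
    let mu := fun lam : Cplx R => th1 * t / (q * k1 * k2) + d * lam in
    (forall x : Cplx R, x != 0 ->
      (coef_qx q t k1 k2 th1 lam (mu lam) x @[lam --> 0^']
         --> - (q * (q * k1 * x ^+ 2 + q * k1 * k2 * d * x + th1 * t)))
      /\ (coef_x q k1 k2 lam x @[lam --> 0^'] --> q * k1 * k2 * x ^+ 2))
    /\
    (forall y1 : Cplx R -> Cplx R, meromorphic_Cstar y1 ->
      mero_identity (fun x =>
        y1 (q ^+ 2 * x)
        - q * (q * k1 * x ^+ 2 + q * k1 * k2 * d * x + th1 * t) * y1 (q * x)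
        + q * k1 * k2 * x ^+ 2 * y1 x = 0) ->
      let f := fun x : Cplx R => y1 (q * x) in
      mero_identity (fun x =>
        f (q * x)
        - q * (q * k1 * x ^+ 2 + q * k1 * k2 * d * x + th1 * t) * f x
        + q * k1 * k2 * x ^+ 2 * f (x / q) = 0))).
Proof.
split.
  move=> lam mu om hlam hmu hom Y _ hY y1 z hz.
  have hYq : \forall x \near z^',
      Y (q * (q * x)) = laxA q t k1 k2 th1 lam mu om (q * x) *m Y (q * x).
    exact: (dnbhs_mull hq (hY _ (mulf_neq0 hq hz))).
  near=> x; rewrite /y1 expr2 -mulrA.
  apply: (laxA_elimination (om := om) hq hk1 hlam hmu hom).
  - by near: x; exact: dnbhs_neq_near.
  - by near: x; exact: hY.
  - by near: x; exact: hYq.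
move=> d mu; split=> [x hx|y1 _ hy1 f z hz]; last first.
  (* Here f(qx) = y1(q^2 x) and f(x/q) = y1(x), so this is the equation of [y1] at the same point
     [x]. *)
  near=> x; rewrite /f (mulrA q q) -expr2 (mulrCA q x) divff // mulr1.
  by near: x; exact: hy1.
by split; [exact: cvg_coef_qx|exact: cvg_coef_x].
Unshelve. all: by end_near.
Qed.
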